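(* Let $f\in K[x]$ be a monic (nonconstant) polynomial. Then $\delta(f)=\epsilon(f)$.
   Context: Setting: $K$ is a field and $\nu:K[x]\to\Gamma\cup\{\infty\}$ is a valuation on the polynomial ring in one indeterminate, with $\Gamma$ a totally ordered abelian group, i.e. $\nu(fg)=\nu(f)+\nu(g)$, $\nu(f+g)\ge\min\{\nu(f),\nu(g)\}$, $\nu(1)=0$, $\nu(0)=\infty$. It is assumed that the support of $\nu$ is zero, i.e. $\nu(f)=\infty$ only for $f=0$. $\overline K$ is a fixed algebraic closure of $K$ and $\mu$ is a fixed valuation on $\overline K[x]$ extending $\nu$. Quotients of values by positive integers are taken in the divisible hull of the value group. $\delta$: for a monic nonconstant $f\in K[x]$, $\delta(f):=\max\{\mu(x-a)\mid a\in\overline K \text{ is a root of } f\}$. Formal derivatives: for $f\in K[x]$ and $r\ge 0$, $\partial_r f\in K[x]$ is the uniquely determined polynomial such that $f(x+y)=\sum_{i=0}^{\deg f}\partial_i f(x)\,y^i$ with $y$ an independent variable ($\partial_r f=0$ for $r>\deg f$). Level: for nonzero $f\in K[x]$, $\epsilon(f):=\max_{r\ge 1}\left\{\frac{\nu(f)-\nu(\partial_r f)}{r}\right\}$, where terms with $\partial_r f=0$ are read as $-\infty$. *)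

(* Defs.v *)
From HB Require Import structures.
From mathcomp Require Import all_boot all_order all_algebra.
From mathcomp Require Import zify.

Set Implicit Arguments.
Unset Strict Implicit.
Unset Printing Implicit Defensive.

Import Order.TTheory GRing.Theory.
Local Open Scope ring_scope.
Local Open Scope quotient_scope.

(* Totality is an axiom here rather than inherited from [orderType]: joining
   [zmodType] and [orderType] below [realDomainType] is rejected by
   Hierarchy-Builder. *)
HB.mixin Record isOrderedGroup G of Num.POrderedZmodule G := {
  leo_total : total (<=%R : rel G);
  leo_add2l : forall z x y : G, x <= y -> z + x <= z + y
}.

#[short(type="orderedGroupType")]
HB.structure Definition OrderedGroup :=
  { G of Num.POrderedZmodule G & isOrderedGroup G }.

Section OrderedGroupTheory.
Variable G : orderedGroupType.
Implicit Types x y z : G.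

Lemma leo_add2lE z x y : (z + x <= z + y) = (x <= y).
Proof.
apply/idP/idP; last exact: leo_add2l.
by move/(leo_add2l (- z)); rewrite !addKr.
Qed.

Lemma leo_add2rE z x y : (x + z <= y + z) = (x <= y).
Proof. by rewrite ![_ + z]addrC leo_add2lE. Qed.

Lemma lto_add2lE z x y : (z + x < z + y) = (x < y).
Proof. by rewrite !lt_neqAle leo_add2lE (inj_eq (addrI z)). Qed.

Lemma leo_add x y z t : x <= y -> z <= t -> x + z <= y + t.
Proof.
by move=> xy zt; apply: (@le_trans _ _ (x + t));
  rewrite ?leo_add2lE ?leo_add2rE.
Qed.

Lemma leo_muln n x y : x <= y -> x *+ n <= y *+ n.
Proof.
by move=> xy; elim: n => [|n IHn]; rewrite ?mulr0n // !mulrS leo_add.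
Qed.

Lemma lto_muln n x y : (0 < n)%N -> x < y -> x *+ n < y *+ n.
Proof.
case: n => // n _ xy; rewrite !mulrS.
apply: (@lt_le_trans _ _ (y + x *+ n)).
  by rewrite ![_ + x *+ n]addrC lto_add2lE.
by rewrite leo_add2lE leo_muln ?ltW.
Qed.

Lemma leo_mulnE n x y : (0 < n)%N -> (x *+ n <= y *+ n) = (x <= y).
Proof.
move=> n_gt0; case: (comparable_leP (leo_total x y)) => xy.
  exact: leo_muln.
by apply/negbTE; rewrite (lt_geF (lto_muln n_gt0 xy)).
Qed.

Lemma eqo_mulnE n x y : (0 < n)%N -> (x *+ n == y *+ n) = (x == y).
Proof. by move=> n_gt0; rewrite !eq_le !leo_mulnE. Qed.

End OrderedGroupTheory.

(** Divisible hull *)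

(* The pair [(x, n)] stands for [x / n.+1]. *)
Section DivisibleHull.
Variable G : orderedGroupType.
Implicit Types (x y : G) (p q : G * nat).

Definition hull_equiv p q := p.1 *+ q.2.+1 == q.1 *+ p.2.+1.

Lemma hull_equiv_refl : reflexive hull_equiv.
Proof. by move=> p; rewrite /hull_equiv. Qed.

Lemma hull_equiv_sym : symmetric hull_equiv.
Proof. by move=> p q; rewrite /hull_equiv eq_sym. Qed.

Lemma hull_equiv_trans : transitive hull_equiv.
Proof.
move=> q p r /eqP pq /eqP qr; rewrite /hull_equiv.
by rewrite -(@eqo_mulnE _ q.2.+1) // mulrnAC pq mulrnAC qr mulrnAC.
Qed.

Canonical hull_equiv_rel :=
  EquivRel hull_equiv hull_equiv_refl hull_equiv_sym hull_equiv_trans.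

Definition hull := {eq_quot hull_equiv}.

HB.instance Definition _ : EqQuotient _ hull_equiv hull := EqQuotient.on hull.
HB.instance Definition _ := Choice.on hull.

Implicit Types u v w : hull.

Definition hull_num u : G := (repr u).1.
Definition hull_den u : nat := (repr u).2.+1.

(* The quotient [x / n]; only meaningful for [0 < n]. *)
Definition frac x (n : nat) : hull := \pi_hull (x, n.-1).

Lemma hull_den_gt0 u : (0 < hull_den u)%N. Proof. by []. Qed.

Lemma frac_numden u : frac (hull_num u) (hull_den u) = u.
Proof. by rewrite /frac /= -surjective_pairing reprK. Qed.

Lemma eq_frac x m y n : (0 < m)%N -> (0 < n)%N ->
  (frac x m == frac y n) = (x *+ n == y *+ m).
Proof. by case: m n => [|m] [|n] // _ _; rewrite /frac eqmodE. Qed.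

Lemma fracW (P : hull -> Prop) :
  (forall x n, (0 < n)%N -> P (frac x n)) -> forall u, P u.
Proof. by move=> Pfrac u; rewrite -(frac_numden u); apply: Pfrac. Qed.

Lemma numden_frac x n : (0 < n)%N ->
  hull_num (frac x n) *+ n = x *+ hull_den (frac x n).
Proof. by move=> n_gt0; apply/eqP; rewrite -eq_frac // frac_numden. Qed.

Definition hull_add u v :=
  frac (hull_num u *+ hull_den v + hull_num v *+ hull_den u)
       (hull_den u * hull_den v).
Definition hull_opp u := frac (- hull_num u) (hull_den u).
Definition hull_le u v :=
  hull_num u *+ hull_den v <= hull_num v *+ hull_den u.

Lemma hull_add_frac x m y n : (0 < m)%N -> (0 < n)%N ->
  hull_add (frac x m) (frac y n) = frac (x *+ n + y *+ m) (m * n).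
Proof.
move=> m0 n0; apply/eqP; rewrite eq_frac ?muln_gt0 ?m0 //.
set u := frac x m; set v := frac y n.
have -> : (hull_num u *+ hull_den v + hull_num v *+ hull_den u) *+ (m * n)
    = (hull_num u *+ m) *+ (hull_den v * n)
      + (hull_num v *+ n) *+ (hull_den u * m).
  by rewrite mulrnDl -!mulrnA; congr (_ *+ _ + _ *+ _); nia.
rewrite /u /v !numden_frac // -/u -/v mulrnDl -!mulrnA.
by apply/eqP; congr (_ *+ _ + _ *+ _); nia.
Qed.

Lemma hull_opp_frac x n : (0 < n)%N -> hull_opp (frac x n) = frac (- x) n.
Proof.
by move=> n0; apply/eqP; rewrite eq_frac // !mulNrn numden_frac.
Qed.

Lemma hull_le_frac x m y n : (0 < m)%N -> (0 < n)%N ->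
  hull_le (frac x m) (frac y n) = (x *+ n <= y *+ m).
Proof.
move=> m0 n0; rewrite /hull_le; set u := frac x m; set v := frac y n.
have mn0 : (0 < m * n)%N by rewrite muln_gt0 m0.
have uv0 : (0 < hull_den u * hull_den v)%N by rewrite muln_gt0.
rewrite -(leo_mulnE _ _ mn0) -[RHS](leo_mulnE _ _ uv0).
have -> : hull_num u *+ hull_den v *+ (m * n)
    = x *+ n *+ (hull_den u * hull_den v).
  rewrite -!mulrnA mulnCA mulrnA numden_frac // -/u -mulrnA.
  by congr (_ *+ _); nia.
have -> // : hull_num v *+ hull_den u *+ (m * n)
    = y *+ m *+ (hull_den u * hull_den v).
rewrite -!mulrnA [(m * n)%N]mulnC mulnCA mulrnA numden_frac // -/v -mulrnA.
by congr (_ *+ _); nia.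
Qed.

Lemma hull_addA : associative hull_add.
Proof.
elim/fracW=> x m m0; elim/fracW=> y n n0; elim/fracW=> z p p0.
rewrite !hull_add_frac ?muln_gt0 ?m0 ?n0 ?p0 // mulnA; congr frac.
rewrite !mulrnDl -!mulrnA addrA.
by congr (_ *+ _ + _ *+ _ + _ *+ _); nia.
Qed.

Lemma hull_addC : commutative hull_add.
Proof. by move=> u v; rewrite /hull_add addrC mulnC. Qed.

Lemma hull_add0 : left_id (frac 0 1) hull_add.
Proof.
elim/fracW=> x n n0.
by rewrite hull_add_frac // mul0rn add0r mulr1n mul1n.
Qed.

Lemma hull_addN : left_inverse (frac 0 1) hull_opp hull_add.
Proof.
elim/fracW=> x n n0; rewrite hull_opp_frac // hull_add_frac //.
apply/eqP; rewrite eq_frac ?muln_gt0 ?n0 //.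
by rewrite mulNrn addNr !mul0rn.
Qed.

HB.instance Definition _ := GRing.isZmodule.Build hull
  hull_addA hull_addC hull_add0 hull_addN.

Lemma hull_le_refl : reflexive hull_le.
Proof. by move=> u; rewrite /hull_le. Qed.

Lemma hull_le_anti : antisymmetric hull_le.
Proof.
elim/fracW=> x m m0; elim/fracW=> y n n0.
by rewrite !hull_le_frac // => /le_anti xy; apply/eqP; rewrite eq_frac // xy.
Qed.

Lemma hull_le_trans : transitive hull_le.
Proof.
elim/fracW=> y n n0; elim/fracW=> x m m0; elim/fracW=> z p p0.
rewrite !hull_le_frac // => xy yz; rewrite -(leo_mulnE _ _ n0) mulrnAC.
rewrite (le_trans (leo_muln p xy)) // mulrnAC.
by rewrite (mulrnAC z) leo_muln.
Qed.

Lemma hull_le_total : total hull_le.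
Proof. by move=> u v; apply: leo_total. Qed.

HB.instance Definition _ := Order.Le_isPOrder.Build ring_display hull
  hull_le_refl hull_le_anti hull_le_trans.

Lemma hull_le_add2l u v w : v <= w -> u + v <= u + w.
Proof.
elim/fracW: u => x m m0; elim/fracW: v => y n n0; elim/fracW: w => z p p0.
rewrite /Order.le /= /GRing.add /= !hull_add_frac // !hull_le_frac //;
  rewrite ?muln_gt0 ?m0 // => yz.
rewrite !mulrnDl -!mulrnA.
have -> : (n * (m * p) = p * (m * n))%N by nia.
have -> : (m * (m * p) = p * (m * m))%N by nia.
have -> : (m * (m * n) = n * (m * m))%N by nia.
by rewrite leo_add2lE (mulrnA y) (mulrnA z) leo_muln.
Qed.

HB.instance Definition _ := isOrderedGroup.Build hull
  hull_le_total hull_le_add2l.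

Lemma addr_frac x m y n : (0 < m)%N -> (0 < n)%N ->
  frac x m + frac y n = frac (x *+ n + y *+ m) (m * n).
Proof. exact: hull_add_frac. Qed.

Lemma oppr_frac x n : (0 < n)%N -> - frac x n = frac (- x) n.
Proof. exact: hull_opp_frac. Qed.

Lemma le_frac x m y n : (0 < m)%N -> (0 < n)%N ->
  (frac x m <= frac y n) = (x *+ n <= y *+ m).
Proof. exact: hull_le_frac. Qed.

Lemma frac1_additive : {morph frac^~ 1%N : x y / x + y}.
Proof. by move=> x y; rewrite addr_frac // !mulr1n. Qed.

Lemma frac1_mono : {mono frac^~ 1%N : x y / x <= y}.
Proof. by move=> x y; rewrite le_frac // !mulr1n. Qed.

Lemma frac_muln x n k : (0 < n)%N -> frac x n *+ k = frac (x *+ k) n.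
Proof.
move=> n0; elim: k => [|k IHk].
  by rewrite !mulr0n; apply/eqP; rewrite eq_frac // !mul0rn.
rewrite !mulrS IHk addr_frac //; apply/eqP.
by rewrite eq_frac ?muln_gt0 ?n0 // mulrnA mulrnDl.
Qed.

Lemma frac_mulnK x n : (0 < n)%N -> frac x n *+ n = frac x 1.
Proof.
by move=> n0; rewrite frac_muln //; apply/eqP; rewrite eq_frac // mulr1n.
Qed.

Lemma hull_divisible u n : (0 < n)%N -> exists v, v *+ n = u.
Proof.
elim/fracW: u => x m m0 n0; exists (frac x (m * n)).
rewrite frac_muln ?muln_gt0 ?m0 //; apply/eqP.
by rewrite eq_frac ?muln_gt0 ?m0 // -mulrnA mulnC.
Qed.

End DivisibleHull.

Notation "x /: n" := (frac x n) (at level 40, left associativity) : ring_scope.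

Section HullMap.
Variables (G H : orderedGroupType) (phi : {additive G -> H}).

Definition hull_map (u : hull G) : hull H := phi (hull_num u) /: hull_den u.

Lemma hull_map_frac x n : (0 < n)%N -> hull_map (x /: n) = phi x /: n.
Proof.
move=> n0; apply/eqP; rewrite eq_frac //.
by rewrite -(raddfMn phi) numden_frac // raddfMn.
Qed.

End HullMap.

(** Values with infinite elements *)

(* Both [G] with [+oo], where valuations take their values, and [G] with
   [-oo], in which the level is computed, are parts of [ext G]. *)
Variant ext (G : Type) : Type := NInf | Fin of G | PInf.
Arguments NInf {G}.
Arguments Fin {G} x.
Arguments PInf {G}.

Definition ext_map (A B : Type) (h : A -> B) (x : ext A) : ext B :=
  match x with NInf => NInf | Fin a => Fin (h a) | PInf => PInf end.

Section ExtChoice.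
Variable G : choiceType.

Definition ext_code (x : ext G) : option (option G) :=
  match x with NInf => None | Fin a => Some (Some a) | PInf => Some None end.
Definition ext_decode (x : option (option G)) : ext G :=
  match x with None => NInf | Some (Some a) => Fin a | Some None => PInf end.

Lemma ext_codeK : cancel ext_code ext_decode. Proof. by case. Qed.

HB.instance Definition _ := Choice.copy (ext G) (can_type ext_codeK).

End ExtChoice.

Section ExtOrder.
Variable G : orderedGroupType.
Implicit Types x y : ext G.

Definition ext_le x y :=
  match x, y with
  | NInf, _ | _, PInf => true
  | Fin a, Fin b => a <= b
  | _, _ => false
  end.

Lemma ext_le_refl : reflexive ext_le.
Proof. by case=> /=. Qed.

Lemma ext_le_anti : antisymmetric ext_le.
Proof. by case=> [|a|] [|b|] //= /le_anti ->. Qed.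

Lemma ext_le_trans : transitive ext_le.
Proof. by case=> [|a|] [|b|] [|c|] //=; apply: le_trans. Qed.

Lemma ext_le_total : total ext_le.
Proof. by case=> [|a|] [|b|] //=; apply: leo_total. Qed.

HB.instance Definition _ := Order.Le_isPOrder.Build ring_display (ext G)
  ext_le_refl ext_le_anti ext_le_trans.
HB.instance Definition _ := Order.POrder_isTotal.Build ring_display (ext G)
  ext_le_total.

Lemma ext_le0 x : NInf <= x. Proof. by []. Qed.

Lemma le_Fin (a b : G) : (Fin a <= Fin b) = (a <= b). Proof. by []. Qed.

(* [+oo + -oo] is [-oo]; it never occurs between values of a valuation. *)
Definition ext_add x y :=
  match x, y with
  | NInf, _ | _, NInf => NInf
  | PInf, _ | _, PInf => PInf
  | Fin a, Fin b => Fin (a + b)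
  end.

Definition ext_opp x :=
  match x with NInf => PInf | Fin a => Fin (- a) | PInf => NInf end.

(* In particular [a - +oo] is [-oo] for every [a]. *)
Definition ext_sub x y := ext_add x (ext_opp y).

End ExtOrder.

Section Valuation.
Variables (F : fieldType) (G : orderedGroupType).

Record is_valuation (v : {poly F} -> ext G) : Prop := IsValuation {
  valuation_codomain : forall p, v p != NInf;
  valuationM : forall p q, v (p * q) = ext_add (v p) (v q);
  valuationD : forall p q, Order.min (v p) (v q) <= v (p + q);
  valuation1 : v 1 = Fin 0;
  valuation0 : v 0 = PInf
}.

Definition zero_support (v : {poly F} -> ext G) : Prop :=
  forall p, v p = PInf -> p = 0.

End Valuation.

Definition is_algebraic_closure (K : fieldType) (L : closedFieldType)
    (iota : {rmorphism K -> L}) : Prop :=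
  forall a : L, algebraicOver iota a.

(* The roots of [p] with multiplicity; empty if [p] is constant. *)
Definition roots_of (L : closedFieldType) (p : {poly L}) : seq L :=
  sval (closed_field_poly_normal p).

Lemma mem_roots_of (L : closedFieldType) (p : {poly L}) :
  p != 0 -> roots_of p =i root p.
Proof.
rewrite /roots_of; case: closed_field_poly_normal => r /= Dp p0 a.
by rewrite -[RHS]/(root p a) Dp rootZ ?lead_coef_eq0 // root_prod_XsubC.
Qed.

Definition delta (K : fieldType) (L : closedFieldType)
    (iota : {rmorphism K -> L}) (G : orderedGroupType)
    (mu : {poly L} -> ext G) (f : {poly K}) : ext G :=
  \big[Order.max/NInf]_(a <- roots_of (map_poly iota f)) mu ('X - a%:P).

(* [f^`N(r)] is the polynomial called [\partial_r f] in the literature on key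
   polynomials: it is the coefficient of [y ^+ r] in [f(x + y)]. Below, [x] is
   the inner and [y] the outer variable of [{poly {poly K}}]. *)
Lemma taylor_nderivn (K : fieldType) (f : {poly K}) :
  f^:P \Po ('X%:P + 'X) = \sum_(i < size f) (f^`N(i))%:P * 'X^i.
Proof.
have -> : f^:P \Po ('X%:P + 'X) = f^:P^:P.['X%:P + 'X] by [].
rewrite nderiv_taylor; last exact: commr_polyX.
rewrite !size_map_polyC; apply: eq_bigr => i _; congr (_ * _).
by rewrite !nderivn_map horner_map /= -[_.['X]]/(_ \Po 'X) comp_polyXr.
Qed.

(* The terms with [size f <= r] are omitted: there [f^`N(r)] is zero and the
   term would be [-oo]. *)
Definition epsilon (K : fieldType) (G : orderedGroupType)
    (nu : {poly K} -> ext G) (f : {poly K}) : ext (hull G) :=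
  \big[Order.max/NInf]_(1 <= r < size f)
    ext_map (fun x => x /: r) (ext_sub (nu f) (nu f^`N(r))).

(* Main.v *)
Require Import Defs.
From HB Require Import structures.
From mathcomp Require Import all_boot all_order all_algebra.

(** Let [d] be the maximum of [mu ('X - a)] over the roots [a] of [f], and
    count roots with multiplicity. Expanding
    [f (x + y) = \prod_a (y + (x - a))] in powers of [y] shows that the
    [r]-th Taylor coefficient [f^`N(r)] is the sum, over the sets of [r]
    roots, of the product of the ['X - a] for the other roots [a]. Removing
    [r] factors from [f] lowers the value by at most [d *+ r], so
    [mu f <= mu f^`N(r) + d *+ r], which is the bound of the level by [d].
    When [r] is the number [m] of roots with [mu ('X - a) = d], exactly one
    choice of [r] factors lowers the value by [d *+ r], so that no
    cancellation occurs and equality holds; as [1 <= m < size f], the level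
    is [d].

    The sums over sets of roots are replaced by an induction on the list of
    roots, [taylor_weight_prod], which also has to carry the strict
    inequality for [r > m]. It rests on the Leibniz rule [nderivn_XsubCM],
    whose two summands record whether the factor ['X - a] is kept or
    removed. All of this takes place over the algebraically closed field;
    that [phi] preserves the order makes the level compatible with extending
    the valuation ([epsilon_map]). *)

Set Implicit Arguments.
Unset Strict Implicit.
Unset Printing Implicit Defensive.

Import Order.TTheory GRing.Theory.
Local Open Scope ring_scope.

(** * Ordered groups with infinite elements *)

Section ExtArithmetic.
Variable G : orderedGroupType.
Implicit Types (x y z : ext G) (c d : G).

Lemma ext_addC : commutative (@ext_add G).
Proof. by case=> [|a|] [|b|] //=; rewrite addrC. Qed.

Lemma ext_addA : associative (@ext_add G).
Proof. by case=> [|a|] [|b|] [|c|] //=; rewrite addrA. Qed.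

Lemma ext_add0 x : ext_add x (Fin 0) = x.
Proof. by case: x => //= a; rewrite addr0. Qed.

Lemma ext_leD2r c x y : (ext_add x (Fin c) <= ext_add y (Fin c)) = (x <= y).
Proof. by case: x y => [|a|] [|b|] //=; rewrite !le_Fin leo_add2rE. Qed.

Lemma ext_leD2l c x y : (ext_add (Fin c) x <= ext_add (Fin c) y) = (x <= y).
Proof. by rewrite !(ext_addC (Fin c)) ext_leD2r. Qed.

Lemma ext_ltD2r c x y : (ext_add x (Fin c) < ext_add y (Fin c)) = (x < y).
Proof. by rewrite !ltNge ext_leD2r. Qed.

Lemma ext_ltD2l c x y : (ext_add (Fin c) x < ext_add (Fin c) y) = (x < y).
Proof. by rewrite !ltNge ext_leD2l. Qed.

(** The first summand has to be finite: infinity would absorb the strict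
    inequality [c < d]. *)
Lemma ext_ltD c d a y :
  c < d -> Fin a <= y -> ext_add (Fin c) (Fin a) < ext_add (Fin d) y.
Proof.
move=> cd ay; apply: (@lt_le_trans _ _ (ext_add (Fin d) (Fin a))).
  by rewrite ext_ltD2r ltNge le_Fin (lt_geF cd).
by rewrite ext_leD2l.
Qed.

End ExtArithmetic.

Section ExtMap.
Variables (G H : orderedGroupType) (h : G -> H).
Hypothesis h_mono : {mono h : x y / x <= y}.

Lemma ext_map_mono : {mono ext_map h : x y / x <= y}.
Proof. by case=> [|a|] [|b|] //=; rewrite !le_Fin h_mono. Qed.

Lemma ext_map_max : {morph ext_map h : x y / Order.max x y}.
Proof.
move=> x y; case: (leP x y) => xy; first by rewrite max_r // ext_map_mono.
by rewrite max_l // ext_map_mono ltW.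
Qed.

End ExtMap.

Section HullMapMono.
Variables (G H : orderedGroupType) (phi : {additive G -> H}).
Hypothesis phi_mono : {mono phi : x y / x <= y}.

Lemma hull_map_mono : {mono hull_map phi : u v / u <= v}.
Proof.
elim/fracW=> x m m0; elim/fracW=> y n n0.
by rewrite !hull_map_frac // !le_frac // -!raddfMn phi_mono.
Qed.

End HullMapMono.

Section LevelTerm.
Variables (G : orderedGroupType) (d : G).

(** An infinite [y] is the value of a vanishing Taylor coefficient; the term
    of the level is then minus infinity. *)
Lemma level_term_le (e : G) y r : (0 < r)%N -> y != NInf ->
  (ext_map (fun x => x /: r) (ext_sub (Fin e) y) <= Fin (d /: 1))
    = (Fin e <= ext_add y (Fin (d *+ r))).
Proof.
move=> r0; case: y => //= b _.
by rewrite !le_Fin le_frac // mulr1n -[e - b <= _](leo_add2rE b) subrK addrC.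
Qed.

Lemma level_term_ge (e : G) y r : (0 < r)%N -> y != NInf ->
  (Fin (d /: 1) <= ext_map (fun x => x /: r) (ext_sub (Fin e) y))
    = (ext_add y (Fin (d *+ r)) <= Fin e).
Proof.
move=> r0; case: y => //= b _.
by rewrite !le_Fin le_frac // mulr1n -[_ <= e - b](leo_add2rE b) subrK addrC.
Qed.

End LevelTerm.

(** * Valuations and Taylor coefficients *)

Section ValuationTheory.
Variables (F : fieldType) (G : orderedGroupType) (v : {poly F} -> ext G).
Hypothesis val_v : is_valuation v.
Implicit Types p q : {poly F}.

(** [v (-1)] is a torsion element, and an ordered group is torsion free. *)
Lemma valuationN1 : v (-1) = Fin 0.
Proof.
have := valuationM val_v (-1) (-1); rewrite mulrNN mulr1 (valuation1 val_v).
case: (v (-1)) => [//|x [/esym x2]|//]; congr Fin.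
by apply/eqP; rewrite -(@eqo_mulnE _ 2) // mul0rn mulr2n x2.
Qed.

Lemma valuationN p : v (- p) = v p.
Proof. by rewrite -mulN1r (valuationM val_v) valuationN1 ext_addC ext_add0. Qed.

Lemma valuationD_le x p q : x <= v p -> x <= v q -> x <= v (p + q).
Proof.
by move=> xp xq; apply: le_trans (valuationD val_v p q); rewrite le_min xp.
Qed.

Lemma valuationD_lt x p q : x < v p -> x < v q -> x < v (p + q).
Proof.
by move=> xp xq; apply: lt_le_trans (valuationD val_v p q); rewrite lt_min xp.
Qed.

Lemma valuationD_dominant p q : v p < v q -> v (p + q) = v p.
Proof.
move=> pq; apply/eqP; rewrite eq_le valuationD_le ?(ltW pq) // andbT.
rewrite leNgt; apply/negP => ppq.
have := @valuationD_lt (v p) (p + q) (- q) ppq.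
by rewrite valuationN addrK ltxx => /(_ pq).
Qed.

Lemma nderivn_XsubCM (a : F) p r :
  (('X - a%:P) * p)^`N(r.+1) = ('X - a%:P) * p^`N(r.+1) + p^`N(r).
Proof.
have -> : ('X - a%:P) * p = p * 'X + 0%:P - a *: p.
  by rewrite addr0 mulrBl mul_polyC mulrC.
rewrite linearB /= nderivnMXaddC linearZ /= mulrBl mul_polyC.
by rewrite -addrA addrC ['X * _]mulrC.
Qed.

(** The value of the [r]-th term of the expansion [p (x + y)] when [y] is
    given the value [d]. *)
Definition taylor_weight (d : G) p (r : nat) : ext G :=
  ext_add (v p^`N(r)) (Fin (d *+ r)).

Lemma taylor_weight0 d p : taylor_weight d p 0 = v p.
Proof. by rewrite /taylor_weight nderivn0 mulr0n ext_add0. Qed.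

Section TaylorWeightStep.
Variables (d c : G) (a : F) (p : {poly F}).
Hypothesis Da : v ('X - a%:P) = Fin c.

Let kept r : ext_add (Fin c) (taylor_weight d p r)
  = ext_add (v (('X - a%:P) * p^`N(r))) (Fin (d *+ r)).
Proof. by rewrite (valuationM val_v) Da /taylor_weight ext_addA. Qed.

Let removed r : ext_add (Fin d) (taylor_weight d p r)
  = ext_add (v p^`N(r)) (Fin (d *+ r.+1)).
Proof. by rewrite /taylor_weight ext_addC -ext_addA /= mulrSr. Qed.

Lemma taylor_weight_XsubCM0 :
  taylor_weight d (('X - a%:P) * p) 0 = ext_add (Fin c) (v p).
Proof. by rewrite taylor_weight0 (valuationM val_v) Da. Qed.

(* Writing a bound as a sum with [k] allows cancelling [k] from inequalities
   between weights, which leaves inequalities between values of [v]. *)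
Let shift (x : ext G) k : x = ext_add (ext_add x (Fin (- k))) (Fin k).
Proof. by rewrite -ext_addA /= addNr ext_add0. Qed.

Lemma taylor_weight_XsubCM_le x r :
    x <= ext_add (Fin c) (taylor_weight d p r.+1) ->
    x <= ext_add (Fin d) (taylor_weight d p r) ->
  x <= taylor_weight d (('X - a%:P) * p) r.+1.
Proof.
rewrite kept removed [x](shift _ (d *+ r.+1)) /taylor_weight nderivn_XsubCM.
by rewrite !ext_leD2r; apply: valuationD_le.
Qed.

Lemma taylor_weight_XsubCM_lt x r :
    x < ext_add (Fin c) (taylor_weight d p r.+1) ->
    x < ext_add (Fin d) (taylor_weight d p r) ->
  x < taylor_weight d (('X - a%:P) * p) r.+1.
Proof.
rewrite kept removed [x](shift _ (d *+ r.+1)) /taylor_weight nderivn_XsubCM.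
by rewrite !ext_ltD2r; apply: valuationD_lt.
Qed.

Lemma taylor_weight_XsubCM_kept r :
    ext_add (Fin c) (taylor_weight d p r.+1)
      < ext_add (Fin d) (taylor_weight d p r) ->
  taylor_weight d (('X - a%:P) * p) r.+1
    = ext_add (Fin c) (taylor_weight d p r.+1).
Proof.
rewrite kept removed ext_ltD2r => /valuationD_dominant <-.
by rewrite -nderivn_XsubCM.
Qed.

Lemma taylor_weight_XsubCM_removed r :
    ext_add (Fin d) (taylor_weight d p r)
      < ext_add (Fin c) (taylor_weight d p r.+1) ->
  taylor_weight d (('X - a%:P) * p) r.+1
    = ext_add (Fin d) (taylor_weight d p r).
Proof.
rewrite kept removed ext_ltD2r => /valuationD_dominant <-.
by rewrite [p^`N(r) + _]addrC -nderivn_XsubCM.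
Qed.

End TaylorWeightStep.

(** * Products of linear factors *)

Section ProductOfLinearFactors.
Variable d : G.

Definition dominated (s : seq F) := {in s, forall a, v ('X - a%:P) <= Fin d}.

Definition count_max (s : seq F) :=
  count (fun a => v ('X - a%:P) == Fin d) s.

Lemma XsubC_Fin (a : F) :
  v ('X - a%:P) <= Fin d -> exists2 c, v ('X - a%:P) = Fin c & c <= d.
Proof.
move=> a_le; have := valuation_codomain val_v ('X - a%:P).
by case: (v _) a_le => [|c|] // cd _; exists c.
Qed.

Lemma prod_XsubC_Fin s :
  dominated s -> exists c, v (\prod_(a <- s) ('X - a%:P)) = Fin c.
Proof.
elim: s => [|a s IHs] le_d.
  by exists 0; rewrite big_nil (valuation1 val_v).
have [c Da _] := XsubC_Fin (le_d a (mem_head a s)).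
have [|e De] := IHs; first by move=> b sb; apply: le_d; rewrite inE sb orbT.
by exists (c + e); rewrite big_cons (valuationM val_v) Da De.
Qed.

(** If [m] of the factors have value [d] and the others smaller values, the
    [m]-th Taylor term attains the weight [v p] of the constant term, and it
    is the last one to do so. The strict part is what makes the equality
    survive one more factor of value [d]: the summand where this factor is
    kept is then negligible. *)
Lemma taylor_weight_prod s (p := \prod_(a <- s) ('X - a%:P)) :
    dominated s ->
  [/\ forall r, v p <= taylor_weight d p r,
      taylor_weight d p (count_max s) = v p
    & forall r, (count_max s < r)%N -> v p < taylor_weight d p r].
Proof.
rewrite {}/p; elim: s => [|a s IHs] le_d.
  rewrite big_nil /=; split=> [[|r]||[|r] // _].
  - by rewrite taylor_weight0.
  - by rewrite /taylor_weight nderivnC (valuation0 val_v) (valuation1 val_v).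
  - by rewrite taylor_weight0.
  - by rewrite /taylor_weight nderivnC (valuation0 val_v) (valuation1 val_v).
have [c Da cd] := XsubC_Fin (le_d a (mem_head a s)).
have s_le_d : dominated s by move=> b sb; apply: le_d; rewrite inE sb orbT.
have [e De] := prod_XsubC_Fin s_le_d.
case: (IHs s_le_d) => {IHs}; rewrite big_cons /= Da (valuationM val_v) Da.
move: (\prod_(_ <- s) _) De (count_max s) => p De m ge_p eq_m gt_m.
have [[Dc]|c_neq] := eqVneq (Fin c) (Fin d).
  (* The factor has value [d]: the [m]-th term moves to place [m.+1]. *)
  rewrite Dc in Da *; rewrite add1n; split=> [[|r]||[|r] // lt_mr].
  - by rewrite (taylor_weight_XsubCM0 _ _ Da).
  - by apply: (taylor_weight_XsubCM_le Da); rewrite ext_leD2l.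
  - rewrite (taylor_weight_XsubCM_removed Da) ?eq_m // ext_ltD2l.
    exact: gt_m.
  - apply: (taylor_weight_XsubCM_lt Da); rewrite ext_ltD2l gt_m //.
    exact: ltnW.
have {}cd : c < d.
  by rewrite lt_neqAle cd andbT; apply: contra_neq c_neq => ->.
(* The factor has value less than [d]: the summands where it is removed never
   reach the least weight. *)
have lt_removed r :
    ext_add (Fin c) (v p) < ext_add (Fin d) (taylor_weight d p r).
  by rewrite De; apply: ext_ltD; rewrite // -De.
rewrite add0n; split=> [[|r]||[|r] // lt_mr].
- by rewrite (taylor_weight_XsubCM0 _ _ Da).
- by apply: (taylor_weight_XsubCM_le Da); rewrite ?ext_leD2l // ltW.
- case: m eq_m {gt_m} => [_|m eq_m].
    by rewrite (taylor_weight_XsubCM0 _ _ Da).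
  by rewrite (taylor_weight_XsubCM_kept Da) eq_m.
- by apply: (taylor_weight_XsubCM_lt Da); rewrite ?ext_ltD2l ?gt_m.
Qed.

Lemma epsilon_prod_XsubC s :
    dominated s -> (0 < count_max s)%N ->
  epsilon v (\prod_(a <- s) ('X - a%:P)) = Fin (d /: 1).
Proof.
move=> s_le_d m_gt0; have [ge_p eq_m _] := taylor_weight_prod s_le_d.
have [e De] := prod_XsubC_Fin s_le_d; rewrite De in ge_p eq_m.
apply/eqP; rewrite /epsilon eq_le De; apply/andP; split.
  rewrite big_nat; apply: bigmax_le => // r /andP[r_gt0 _].
  by rewrite level_term_le ?(valuation_codomain val_v) //; apply: ge_p.
have m_in : count_max s \in index_iota 1 (size (\prod_(a <- s) ('X - a%:P))).
  by rewrite mem_index_iota m_gt0 size_prod_XsubC ltnS count_size.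
apply: (bigmax_sup_seq _ _ _ _ _ m_in) => //.
rewrite level_term_ge ?(valuation_codomain val_v) //.
by rewrite -[ext_add _ _]/(taylor_weight _ _ _) eq_m.
Qed.

End ProductOfLinearFactors.
End ValuationTheory.

(** * Extension of valuations *)

Section ValuationExtension.
Variables (K L : fieldType) (iota : {rmorphism K -> L}).
Variables (G H : orderedGroupType) (phi : {additive G -> H}).
Hypothesis phi_mono : {mono phi : x y / x <= y}.
Variables (nu : {poly K} -> ext G) (mu : {poly L} -> ext H).
Hypothesis mu_ext :
  forall p : {poly K}, mu (map_poly iota p) = ext_map phi (nu p).

(** Taylor coefficients commute with [iota], and a monotone map commutes
    with finite maxima. *)
Lemma epsilon_map f :
  epsilon mu (map_poly iota f) = ext_map (hull_map phi) (epsilon nu f).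
Proof.
rewrite /epsilon size_map_poly.
rewrite (big_morph _ (ext_map_max (hull_map_mono phi_mono)) (erefl _)).
rewrite !big_nat; apply: eq_bigr => r /andP[r_gt0 _].
rewrite nderivn_map !mu_ext.
case: (nu f) (nu f^`N(r)) => [|x|] [|y|] //=.
by rewrite hull_map_frac // raddfB.
Qed.

End ValuationExtension.

(** * The level is the maximal value of a linear factor *)

Lemma bigmax_ext_attained (I : eqType) (G : orderedGroupType) (s : seq I)
    (F : I -> ext G) : s != [::] ->
  exists2 i, i \in s & \big[Order.max/NInf]_(j <- s) F j = F i.
Proof.
elim: s => // i s IHs _; rewrite big_cons.
have [-> | /IHs[j sj ->]] := eqVneq s [::].
  by exists i; rewrite ?mem_head // big_nil max_l.
case: (leP (F i) (F j)) => _; last by exists i; rewrite ?mem_head.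
by exists j; rewrite // inE sj orbT.
Qed.

Lemma roots_of_monic (L : closedFieldType) (p : {poly L}) :
  p \is monic -> p = \prod_(a <- roots_of p) ('X - a%:P).
Proof.
rewrite /roots_of; case: closed_field_poly_normal => s /= Dp /monicP p1.
by rewrite [LHS]Dp p1 scale1r.
Qed.

Theorem proposition3p1 (K : fieldType) (L : closedFieldType)
    (iota : {rmorphism K -> L}) (algL : is_algebraic_closure iota)
    (G H : orderedGroupType) (phi : {additive G -> H})
    (phi_mono : {mono phi : x y / x <= y})
    (nu : {poly K} -> ext G) (val_nu : is_valuation nu)
    (supp_nu : zero_support nu)
    (mu : {poly L} -> ext H) (val_mu : is_valuation mu)
    (mu_ext : forall p : {poly K}, mu (map_poly iota p) = ext_map phi (nu p))
    (f : {poly K}) (f_monic : f \is monic) (f_nonconst : (1 < size f)%N) :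
  ext_map (fun x => x /: 1) (delta iota mu f)
    = ext_map (hull_map phi) (epsilon nu f).
Proof.
rewrite -(epsilon_map phi_mono mu_ext) /delta.
have Df : map_poly iota f = _ := roots_of_monic (monic_map iota f_monic).
set s := roots_of _ in Df *.
have s_neq0 : s != [::].
  apply: contraTneq f_nonconst => s0.
  by rewrite -(size_map_poly iota) Df s0 big_nil size_poly1.
have [a sa Da] := bigmax_ext_attained (fun a => mu ('X - a%:P)) s_neq0.
(* The zero support of [nu] excludes infinite values at the roots of [f]. *)
have [d Dd] : exists d, mu ('X - a%:P) = Fin d.
  have := valuation_codomain val_mu ('X - a%:P).
  case Ea: (mu ('X - a%:P)) => [|d|] // _; first by exists d.
  have : mu (map_poly iota f) = PInf.
    rewrite Df (big_rem a) //= (valuationM val_mu) Ea.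
    have := valuation_codomain val_mu (\prod_(b <- rem a s) ('X - b%:P)).
    by case: (mu _).
  rewrite mu_ext; case Ef: (nu f) => // _.
  by move: f_nonconst; rewrite (supp_nu _ Ef) size_poly0.
rewrite Da Dd /= Df (@epsilon_prod_XsubC _ _ _ val_mu d) //.
  by move=> b sb; rewrite -Dd -Da; apply: le_bigmax_seq.
by rewrite -has_count; apply/hasP; exists a; rewrite // Dd.
Qed.
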